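(* Let $\mathfrak{p}=(p_1,p_2,p_3,p_4)$ be any quadruple of pairwise distinct points of $\overline{\mathbf{H}^2_{\mathbb{C}}}$, the compactified complex hyperbolic plane endowed with the Cygan metric $\rho$, and let $\mathbb{X}^\rho_1(\mathfrak{p})=\mathbb{X}^\rho(p_1,p_2,p_3,p_4)$ and $\mathbb{X}^\rho_2(\mathfrak{p})=\mathbb{X}^\rho(p_1,p_3,p_2,p_4)$ be its metric cross-ratios. Then $$\mathbb{X}^\rho_1(\mathfrak{p})+\mathbb{X}^\rho_2(\mathfrak{p})\ge 1\quad\text{and}\quad \left|\mathbb{X}^\rho_1(\mathfrak{p})-\mathbb{X}^\rho_2(\mathfrak{p})\right|\le 1.$$
   Context: Complex hyperbolic plane in the Siegel domain model is $\mathbf{H}^2_{\mathbb{C}}=\{(z_1,z_2)\in\mathbb{C}^2: 2\Re(z_1)+|z_2|^2<0\}$, with boundary $\partial\mathbf{H}^2_{\mathbb{C}}=\{(z_1,z_2)\in\mathbb{C}^2: 2\Re(z_1)+|z_2|^2=0\}\cup\{\infty\}$. Horospherical coordinates: a point of $\mathbf{H}^2_{\mathbb{C}}\cup\partial\mathbf{H}^2_{\mathbb{C}}\setminus\{\infty\}$ is written uniquely as $(\zeta,v,u)\in\mathbb{C}\times\mathbb{R}\times[0,\infty)$ via $z_1=-|\zeta|^2-u+iv$, $z_2=\sqrt{2}\,\zeta$; points with $u>0$ are those of $\mathbf{H}^2_{\mathbb{C}}$, points with $u=0$ are the finite boundary points. The compactification is $\overline{\mathbf{H}^2_{\mathbb{C}}}=\mathbf{H}^2_{\mathbb{C}}\cup\partial\mathbf{H}^2_{\mathbb{C}}$,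 identified with $(\mathbb{C}\times\mathbb{R}\times[0,\infty))\cup\{\infty\}$. The Cygan metric is $$\rho\big((\zeta_1,v_1,u_1),(\zeta_2,v_2,u_2)\big)=\Big||\zeta_1-\zeta_2|^2+|u_1-u_2|-iv_1+iv_2-2i\Im(\zeta_1\overline{\zeta_2})\Big|^{1/2},$$ extended by $\rho(p,\infty)=\rho(\infty,p)=+\infty$ for $p\ne\infty$ and $\rho(\infty,\infty)=0$. The metric cross-ratio of a quadruple of pairwise distinct points is $$\mathbb{X}^\rho(p_1,p_2,p_3,p_4)=\frac{\rho(p_2,p_4)}{\rho(p_2,p_3)}\cdot\frac{\rho(p_1,p_3)}{\rho(p_1,p_4)},$$ with the convention $(+\infty):(+\infty)=1$: if one of the points is $\infty$, then the one infinite distance in the numerator and the one in the denominator cancel. *)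

(* Defs.v *)
From Stdlib Require Import Reals Lra.
From Coquelicot Require Import Coquelicot.
Open Scope R_scope.

(* C^2 together with one ideal point, the latter standing for the point at
   infinity of the Siegel domain. *)
Inductive point : Type :=
  | fin_pt : C -> C -> point
  | infty_pt : point.

Definition siegel_form (z1 z2 : C) : R := 2 * Re z1 + Cmod z2 ^ 2.

Definition hyperbolic_plane (p : point) : Prop :=
  match p with
  | fin_pt z1 z2 => siegel_form z1 z2 < 0
  | infty_pt => False
  end.

Definition hyperbolic_boundary (p : point) : Prop :=
  match p with
  | fin_pt z1 z2 => siegel_form z1 z2 = 0
  | infty_pt => True
  end.

Definition compactified_plane (p : point) : Prop :=
  hyperbolic_plane p \/ hyperbolic_boundary p.

(* Horospherical coordinates (zeta, v, u), obtained by solving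
   z1 = - |zeta|^2 - u + i v,  z2 = sqrt 2 * zeta;
   see [horospherical_unique] and [siegel_form_horo_u]. *)
Definition horo_zeta (z1 z2 : C) : C := (z2 / RtoC (sqrt 2))%C.
Definition horo_v (z1 z2 : C) : R := Im z1.
Definition horo_u (z1 z2 : C) : R := - Re z1 - Cmod (horo_zeta z1 z2) ^ 2.

Lemma horospherical_unique (z1 z2 zeta : C) (v u : R) :
  (z1 = (RtoC (- Cmod zeta ^ 2 - u) + Ci * RtoC v)%C /\
   z2 = (RtoC (sqrt 2) * zeta)%C) <->
  (zeta = horo_zeta z1 z2 /\ v = horo_v z1 z2 /\ u = horo_u z1 z2).
Proof.
  assert (s2 : RtoC (sqrt 2) <> RtoC 0).
  { intro H. apply RtoC_inj in H. generalize (sqrt_lt_R0 2). lra. }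
  split.
  - intros [H1 H2].
    assert (Hz : horo_zeta z1 z2 = zeta).
    { unfold horo_zeta. rewrite H2. field. exact s2. }
    unfold horo_u, horo_v. rewrite Hz, H1.
    unfold RtoC, Ci, Re, Im, Cplus, Cmult. simpl.
    repeat split; ring.
  - intros [H1 [H2 H3]]. unfold horo_u in H3. rewrite <- H1 in H3.
    unfold horo_v in H2. rewrite H2, H3. split.
    + destruct z1 as [a b].
      unfold RtoC, Ci, Re, Im, Cplus, Cmult. simpl. f_equal; ring.
    + rewrite H1. unfold horo_zeta. field. exact s2.
Qed.

Lemma siegel_form_horo_u (z1 z2 : C) :
  siegel_form z1 z2 = - (2 * horo_u z1 z2).
Proof.
  assert (s2 : 0 < sqrt 2) by (apply sqrt_lt_R0; lra).
  unfold siegel_form, horo_u, horo_zeta.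
  rewrite Cmod_div, Cmod_R, (Rabs_pos_eq (sqrt 2)) by
    (try (intro H; apply RtoC_inj in H); lra).
  replace ((Cmod z2 / sqrt 2) ^ 2) with (Cmod z2 ^ 2 / (sqrt 2 * sqrt 2))
    by (field; lra).
  rewrite sqrt_sqrt; [field | lra].
Qed.

Definition cygan_horo (zeta1 : C) (v1 u1 : R) (zeta2 : C) (v2 u2 : R) : R :=
  sqrt (Cmod (RtoC (Cmod (zeta1 - zeta2)%C ^ 2) + RtoC (Rabs (u1 - u2))
              - Ci * RtoC v1 + Ci * RtoC v2
              - RtoC 2 * Ci * RtoC (Im (zeta1 * Cconj zeta2)%C))%C).

Definition cygan (p q : point) : Rbar :=
  match p, q with
  | fin_pt z1 z2, fin_pt w1 w2 =>
      Finite (cygan_horo (horo_zeta z1 z2) (horo_v z1 z2) (horo_u z1 z2)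
                         (horo_zeta w1 w2) (horo_v w1 w2) (horo_u w1 w2))
  | infty_pt, infty_pt => Finite 0
  | _, _ => p_infty
  end.

(* Among four distinct points at most one is at infinity; it then occurs in
   exactly one numerator distance and one denominator distance of the
   cross-ratio.  Replacing each infinite distance by 1 therefore implements
   the convention (+oo) : (+oo) = 1.  (Coquelicot's coercion [real] would
   send +oo to 0 instead.) *)
Definition cancel_infty (x : Rbar) : R :=
  match x with
  | Finite r => r
  | _ => 1
  end.

Definition cross_ratio (p1 p2 p3 p4 : point) : R :=
  cancel_infty (cygan p2 p4) / cancel_infty (cygan p2 p3) *
  (cancel_infty (cygan p1 p3) / cancel_infty (cygan p1 p4)).

Definition cross_ratio_1 (p1 p2 p3 p4 : point) : R := cross_ratio p1 p2 p3 p4.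
Definition cross_ratio_2 (p1 p2 p3 p4 : point) : R := cross_ratio p1 p3 p2 p4.

(* Main.v *)
(** Realise the function [|u - u'|] on the finitely many heights involved as a
    squared distance [|f u - f u'|^2] of real vectors. Then
    [(zeta, v, u) |-> ((zeta, f u), v)] embeds the points isometrically into a
    higher-dimensional Heisenberg group. There the squared gauge distance is the
    modulus of the kernel [K(p,q) = a_p + conj a_q - 2 <x_p, x_q>], where
    [a_p = |x_p|^2 - i v_p], and Cauchy-Schwarz gives the triangle inequality.
    Inversion about a point [s] sends [x_p] to [(x_p - x_s) / K(p,s)] and [a_p] to
    [1 / K(p,s)], which divides [K(p,q)] by [K(p,s) conj K(q,s)]; so the triangle
    inequality after inversion is Ptolemy's inequality, and the two claims are
    Ptolemy's inequality (or the triangle inequality if a point is infinite)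
    divided by [rho(p2,p3) rho(p1,p4)]. *)
Require Import Defs.
From Stdlib Require Import Reals Lra List Sorted Permutation Mergesort Orders.
From Coquelicot Require Import Coquelicot.
Open Scope R_scope.

(** * The standard Hermitian form and Cauchy-Schwarz *)

Fixpoint herm (n : nat) (x y : nat -> C) : C :=
  match n with
  | O => RtoC 0
  | S m => (x O * Cconj (y O) + herm m (fun k => x (S k)) (fun k => y (S k)))%C
  end.

Definition vcons {T : Type} (a : T) (x : nat -> T) (k : nat) : T :=
  match k with
  | O => a
  | S m => x m
  end.

(** The coefficients stay general to serve two uses: all equal to 1 for differences of vectors, and
    inverses of kernels for inverted points. *)
Lemma herm_comb (n : nat) (a b c d : C) (x y z w : nat -> C) :
  herm n (fun k => a * x k - b * z k)%C (fun k => c * y k - d * w k)%C =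
  (a * Cconj c * herm n x y - a * Cconj d * herm n x w
   - b * Cconj c * herm n z y + b * Cconj d * herm n z w)%C.
Proof.
  revert x y z w; induction n as [|n IH]; intros x y z w; simpl.
  - ring.
  - rewrite IH, Cminus_conj, !Cmult_conj. ring.
Qed.

Lemma herm_conj (n : nat) (x y : nat -> C) : Cconj (herm n x y) = herm n y x.
Proof.
  revert x y; induction n as [|n IH]; intros x y; simpl.
  - unfold Cconj, RtoC; simpl; f_equal; ring.
  - rewrite Cplus_conj, IH, Cmult_conj, Cconj_conj. ring.
Qed.

Lemma herm_real_im (n : nat) (x y : nat -> R) :
  Im (herm n (fun k => RtoC (x k)) (fun k => RtoC (y k))) = 0.
Proof.
  revert x y; induction n as [|n IH]; intros x y; cbn [herm].
  - reflexivity.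
  - rewrite im_plus, (IH (fun k => x (S k)) (fun k => y (S k))).
    unfold Im, Re; simpl; ring.
Qed.

Lemma Re_mul_Cconj_self (z : C) : Re (z * Cconj z)%C = Cmod z ^ 2.
Proof. rewrite <- Cmod2_conj. apply re_RtoC. Qed.

Lemma herm_self_ge_0 (n : nat) (x : nat -> C) : 0 <= Re (herm n x x).
Proof.
  revert x; induction n as [|n IH]; intros x; cbn [herm].
  - apply Rle_refl.
  - rewrite re_plus, Re_mul_Cconj_self.
    generalize (IH (fun k => x (S k))) (pow2_ge_0 (Cmod (x O))). lra.
Qed.

Lemma cauchy_schwarz_step (a b s t : R) :
  0 <= a -> 0 <= b -> 0 <= s -> 0 <= t ->
  a * b + sqrt s * sqrt t <= sqrt (a ^ 2 + s) * sqrt (b ^ 2 + t).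
Proof.
  intros Ha Hb Hs Ht.
  rewrite <- (sqrt_mult (a ^ 2 + s)) by nra.
  generalize (sqrt_pos s) (sqrt_pos t) (sqrt_sqrt s Hs) (sqrt_sqrt t Ht).
  generalize (sqrt s) (sqrt t). intros p q Hp Hq <- <-.
  rewrite <- (sqrt_pow2 (a * b + p * q)) by nra.
  apply sqrt_le_1_alt.
  (* The radicands differ by exactly [(a * q - b * p) ^ 2]. *)
  generalize (pow2_ge_0 (a * q - b * p)). nra.
Qed.

Lemma herm_cauchy_schwarz (n : nat) (x y : nat -> C) :
  Cmod (herm n x y) <= sqrt (Re (herm n x x)) * sqrt (Re (herm n y y)).
Proof.
  revert x y; induction n as [|n IH]; intros x y; cbn [herm].
  - rewrite Cmod_0. apply Rmult_le_pos; apply sqrt_pos.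
  - rewrite !re_plus, !Re_mul_Cconj_self.
    eapply Rle_trans; [apply Cmod_triangle|].
    rewrite Cmod_mult, Cmod_conj.
    eapply Rle_trans; [apply Rplus_le_compat_l, IH|].
    apply cauchy_schwarz_step; auto using Cmod_ge_0, herm_self_ge_0.
Qed.

(** * The Heisenberg kernel *)

(* The scalar [a] attached to a vector [x] encodes the vertical coordinate: it is
   [|x|^2 - i v], whence the condition [is_lift]. *)
Definition is_lift (n : nat) (x : nat -> C) (a : C) : Prop :=
  (a + Cconj a = 2 * herm n x x)%C.

Definition kernel (n : nat) (x : nat -> C) (a : C) (y : nat -> C) (b : C) : C :=
  (a + Cconj b - 2 * herm n x y)%C.

Definition gauge (n : nat) (x : nat -> C) (a : C) (y : nat -> C) (b : C) : R :=
  sqrt (Cmod (kernel n x a y b)).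

Lemma Cconj_RtoC (r : R) : Cconj (RtoC r) = RtoC r.
Proof. unfold Cconj, RtoC; simpl; f_equal; ring. Qed.

Lemma kernel_conj (n : nat) (x : nat -> C) (a : C) (y : nat -> C) (b : C) :
  Cconj (kernel n x a y b) = kernel n y b x a.
Proof.
  unfold kernel.
  rewrite Cminus_conj, Cplus_conj, Cmult_conj, Cconj_conj, herm_conj, Cconj_RtoC.
  ring.
Qed.

Lemma gauge_sym (n : nat) (x : nat -> C) (a : C) (y : nat -> C) (b : C) :
  gauge n x a y b = gauge n y b x a.
Proof. unfold gauge. now rewrite <- kernel_conj, Cmod_conj. Qed.

(** The lift conditions make [Re a] and [Re b] the squared norms of [x] and [y], so
    [Re K(x,y) = |x-y|^2]. The factors 1 bring the differences into the shape of [herm_comb]. *)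
Lemma herm_sub_self (n : nat) (x : nat -> C) (a : C) (y : nat -> C) (b : C) :
  is_lift n x a -> is_lift n y b ->
  Re (herm n (fun k => 1 * x k - 1 * y k)%C (fun k => 1 * x k - 1 * y k)%C) =
  Re (kernel n x a y b).
Proof.
  intros Hx Hy.
  apply RtoC_inj. rewrite (re_alt (kernel n x a y b)), kernel_conj, re_alt, herm_conj.
  rewrite herm_comb, !Cconj_RtoC. unfold kernel, is_lift in *.
  replace (a + Cconj b - 2 * herm n x y + (b + Cconj a - 2 * herm n y x))%C
    with ((a + Cconj a) + (b + Cconj b) - 2 * herm n x y - 2 * herm n y x)%C by ring.
  rewrite Hx, Hy. field.
Qed.

(** Expanding about [z] gives [K(x,y) = K(x,z) + K(z,y) - 2 <x-z, y-z>]. Since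
    [|x-z|^2 = Re K(x,z) <= |K(x,z)|], and likewise for [y], Cauchy-Schwarz bounds the last term by
    twice the product of the two gauges. Hence [|K(x,y)|] is at most the square of their sum. *)
Lemma gauge_triangle (n : nat) (x y z : nat -> C) (a b c : C) :
  is_lift n x a -> is_lift n y b -> is_lift n z c ->
  gauge n x a y b <= gauge n x a z c + gauge n z c y b.
Proof.
  intros Hx Hy Hz.
  set (h := herm n (fun k => 1 * x k - 1 * z k)%C (fun k => 1 * y k - 1 * z k)%C).
  assert (E : kernel n x a y b =
              (kernel n x a z c + kernel n z c y b + - (2 * h))%C).
  { unfold h. rewrite herm_comb, !Cconj_RtoC. unfold kernel, is_lift in *.
    replace (a + Cconj c - 2 * herm n x z + (c + Cconj b - 2 * herm n z y))%C
      with (a + Cconj b + (c + Cconj c) - 2 * herm n x z - 2 * herm n z y)%C by ring.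
    rewrite Hz. ring. }
  assert (Hh : Cmod h <= gauge n x a z c * gauge n z c y b).
  { eapply Rle_trans; [apply herm_cauchy_schwarz|].
    rewrite (herm_sub_self n x a z c), (herm_sub_self n y b z c) by assumption.
    rewrite (gauge_sym n z c y b).
    apply Rmult_le_compat; try apply sqrt_pos; apply sqrt_le_1_alt;
      (eapply Rle_trans; [apply Rle_abs | apply re_le_Cmod]). }
  assert (T : Cmod (kernel n x a y b) <=
              Cmod (kernel n x a z c) + Cmod (kernel n z c y b) + 2 * Cmod h).
  { rewrite E. eapply Rle_trans; [apply Cmod_triangle|].
    rewrite Cmod_opp, Cmod_mult, Cmod_R, (Rabs_pos_eq 2) by lra.
    apply Rplus_le_compat_r, Cmod_triangle. }
  unfold gauge at 1.
  assert (P : forall x a y b, 0 <= gauge n x a y b) by (intros; apply sqrt_pos).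
  assert (Q : forall x a y b, gauge n x a y b * gauge n x a y b = Cmod (kernel n x a y b))
    by (intros; apply sqrt_sqrt, Cmod_ge_0).
  rewrite <- (sqrt_pow2 (gauge n x a z c + gauge n z c y b))
    by (apply Rplus_le_le_0_compat; apply P).
  apply sqrt_le_1_alt. rewrite <- !Q in T. rewrite <- Q. nra.
Qed.

(** * Inversion and Ptolemy's inequality *)

Lemma Cconj_neq_0 (z : C) : z <> RtoC 0 -> Cconj z <> RtoC 0.
Proof.
  intros Hz H. apply Hz. rewrite <- (Cconj_conj z), H. apply Cconj_RtoC.
Qed.

(** With [K = K(x,z)], one has [1/K + 1/conj K = 2 Re K / |K|^2]. As [Re K = |x-z|^2], this is twice
    the squared norm of [(x-z)/K]. *)
Lemma inversion_is_lift (n : nat) (x z : nat -> C) (a c : C) :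
  is_lift n x a -> is_lift n z c -> kernel n x a z c <> RtoC 0 ->
  is_lift n (fun k => / kernel n x a z c * x k - / kernel n x a z c * z k)%C
            (/ kernel n x a z c)%C.
Proof.
  intros Hx Hz H0. generalize (Cconj_neq_0 _ H0). intro H1.
  unfold is_lift. rewrite herm_comb, Cinv_conj by exact H0.
  transitivity ((kernel n x a z c + Cconj (kernel n x a z c)) /
                (kernel n x a z c * Cconj (kernel n x a z c)))%C.
  { field. split; assumption. }
  replace (kernel n x a z c + Cconj (kernel n x a z c))%C
    with (2 * herm n x x + 2 * herm n z z - 2 * herm n x z - 2 * herm n z x)%C.
  { field. split; assumption. }
  rewrite kernel_conj. unfold kernel. rewrite <- Hx, <- Hz. ring.
Qed.

(** Over the common denominator the claim becomes the expansion of [K(x,y)] about [z] that also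
    gives the triangle inequality, because [conj K(y,z) = K(z,y)]. *)
Lemma kernel_inversion (n : nat) (x y z : nat -> C) (a b c : C) :
  is_lift n z c -> kernel n x a z c <> RtoC 0 -> kernel n y b z c <> RtoC 0 ->
  kernel n (fun k => / kernel n x a z c * x k - / kernel n x a z c * z k)%C
           (/ kernel n x a z c)%C
           (fun k => / kernel n y b z c * y k - / kernel n y b z c * z k)%C
           (/ kernel n y b z c)%C =
  (kernel n x a y b / (kernel n x a z c * Cconj (kernel n y b z c)))%C.
Proof.
  intros Hz Hx Hy. generalize (Cconj_neq_0 _ Hy). intro Hy'.
  unfold kernel at 1. rewrite herm_comb, Cinv_conj by exact Hy.
  replace (kernel n x a y b)
    with (kernel n x a z c + Cconj (kernel n y b z c)
          - 2 * (herm n x y - herm n x z - herm n z y + herm n z z))%C.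
  { field. split; assumption. }
  rewrite kernel_conj. unfold kernel.
  replace (a + Cconj c - 2 * herm n x z + (c + Cconj b - 2 * herm n z y) -
           2 * (herm n x y - herm n x z - herm n z y + herm n z z))%C
    with ((c + Cconj c) - 2 * herm n z z + a + Cconj b - 2 * herm n x y)%C by ring.
  rewrite Hz. ring.
Qed.

Lemma gauge_ptolemy (n : nat) (x y z s : nat -> C) (a b c d : C) :
  is_lift n x a -> is_lift n y b -> is_lift n z c -> is_lift n s d ->
  0 < gauge n x a s d -> 0 < gauge n y b s d -> 0 < gauge n z c s d ->
  gauge n x a y b * gauge n z c s d <=
  gauge n x a z c * gauge n y b s d + gauge n z c y b * gauge n x a s d.
Proof.
  intros Hx Hy Hz Hs Px Py Pz.
  assert (K0 : forall x a, 0 < gauge n x a s d -> kernel n x a s d <> RtoC 0).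
  { intros x' a' P H. unfold gauge in P. rewrite H, Cmod_0, sqrt_0 in P. lra. }
  assert (G : forall x a y b, 0 < gauge n x a s d -> 0 < gauge n y b s d ->
    gauge n (fun k => / kernel n x a s d * x k - / kernel n x a s d * s k)%C
            (/ kernel n x a s d)%C
            (fun k => / kernel n y b s d * y k - / kernel n y b s d * s k)%C
            (/ kernel n y b s d)%C =
    gauge n x a y b / (gauge n x a s d * gauge n y b s d)).
  { intros x' a' y' b' P P'. unfold gauge at 1.
    rewrite kernel_inversion by auto.
    rewrite Cmod_div, Cmod_mult, Cmod_conj
      by (apply Cmult_neq_0; [|apply Cconj_neq_0]; auto).
    rewrite sqrt_div_alt, sqrt_mult; auto using Cmod_ge_0.
    apply Rmult_lt_0_compat; apply Cmod_gt_0; auto. }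
  generalize (gauge_triangle n _ _ _ _ _ _
    (inversion_is_lift n x s a d Hx Hs (K0 _ _ Px))
    (inversion_is_lift n y s b d Hy Hs (K0 _ _ Py))
    (inversion_is_lift n z s c d Hz Hs (K0 _ _ Pz))).
  rewrite !G by assumption. intro T.
  (* Dividing by the three gauges to [s] turns the claim into [T], the triangle inequality for the
     inverted points. *)
  apply (Rmult_le_reg_r (/ (gauge n x a s d * gauge n y b s d * gauge n z c s d))).
  { apply Rinv_0_lt_compat. repeat apply Rmult_lt_0_compat; assumption. }
  eapply Rle_trans; [|eapply Rle_trans; [exact T|]]; right; field; lra.
Qed.

(** * Embedding the heights into a Euclidean space *)

Definition real_sqdist (n : nat) (x y : nat -> R) : R :=
  Re (herm n (fun k => RtoC (x k - y k)) (fun k => RtoC (x k - y k))).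

Lemma real_sqdist_vcons (n : nat) (a b : R) (x y : nat -> R) :
  real_sqdist (S n) (vcons a x) (vcons b y) = (a - b) ^ 2 + real_sqdist n x y.
Proof.
  unfold real_sqdist; cbn [herm vcons]. rewrite re_plus. f_equal.
  unfold Re; simpl; ring.
Qed.

Lemma real_sqdist_refl (n : nat) (x : nat -> R) : real_sqdist n x x = 0.
Proof.
  revert x; induction n as [|n IH]; intro x; [reflexivity|].
  transitivity ((x O - x O) ^ 2 + real_sqdist n (fun k => x (S k)) (fun k => x (S k))).
  - unfold real_sqdist; cbn [herm vcons]. rewrite re_plus. f_equal. unfold Re; simpl; ring.
  - rewrite IH. ring.
Qed.

(* The new coordinate added for the least element [m] is [0] at [m] and
   [sqrt (y - m)] on all other elements, [y] being the least of those. *)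
Lemma sorted_snowflake_embedding (l : list R) :
  StronglySorted Rle l ->
  exists (n : nat) (f : R -> nat -> R),
    forall x y, In x l -> In y l -> real_sqdist n (f x) (f y) = Rabs (x - y).
Proof.
  induction l as [|m l IH]; intro Hl.
  { exists O, (fun _ _ => 0). intros x y []. }
  apply StronglySorted_inv in Hl. destruct Hl as [Hl Hm].
  destruct (IH Hl) as [n [f Hf]]. clear IH.
  rewrite Forall_forall in Hm.
  destruct l as [|y0 l].
  { exists O, (fun _ _ => 0). intros x y [<-|[]] [<-|[]].
    rewrite real_sqdist_refl, Rminus_diag, Rabs_R0. reflexivity. }
  assert (H0 : forall x, In x (y0 :: l) -> y0 <= x).
  { apply StronglySorted_inv in Hl. destruct Hl as [_ Hl].
    rewrite Forall_forall in Hl.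
    intros x [<-|Hx]; [lra | auto]. }
  generalize (Hm y0 (or_introl eq_refl)). intro Hmy.
  set (l' := y0 :: l) in *.
  assert (I0 : In y0 l') by (left; reflexivity).
  (* [Rmax y0 x] gives [m] the old coordinates of [y0], so the squared distance from [m] to a later
     [y] is [(y0 - m) + (y - y0)]. *)
  exists (S n), (fun x => vcons (if Rle_dec y0 x then sqrt (y0 - m) else 0) (f (Rmax y0 x))).
  assert (Rml : forall y, In y l' ->
    (if Rle_dec y0 y then sqrt (y0 - m) else 0) = sqrt (y0 - m) /\ Rmax y0 y = y).
  { intros y Hy. generalize (H0 y Hy). intro.
    destruct (Rle_dec y0 y); [|lra]. split; [reflexivity | now apply Rmax_right]. }
  assert (Rm : (if Rle_dec y0 m then sqrt (y0 - m) else 0) = 0 /\ Rmax y0 m = y0).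
  { split; [|now apply Rmax_left]. destruct (Rle_dec y0 m); [|reflexivity].
    (* The test succeeds at [m] only if [m = y0], and then the new coordinate is still 0. *)
    replace (y0 - m) with 0 by lra. apply sqrt_0. }
  intros x y Hx Hy. rewrite real_sqdist_vcons.
  destruct Hx as [<-|Hx]; destruct Hy as [<-|Hy].
  - rewrite real_sqdist_refl, !Rminus_diag, Rabs_R0. ring.
  - destruct Rm as [-> ->]. destruct (Rml y Hy) as [-> ->].
    rewrite Hf by assumption. generalize (H0 y Hy). intro.
    rewrite !Rabs_left1 by lra.
    replace ((0 - sqrt (y0 - m)) ^ 2) with (sqrt (y0 - m) * sqrt (y0 - m)) by ring.
    rewrite sqrt_sqrt; lra.
  - destruct Rm as [-> ->]. destruct (Rml x Hx) as [-> ->].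
    rewrite Hf by assumption. generalize (H0 x Hx). intro.
    rewrite !Rabs_pos_eq by lra.
    replace ((sqrt (y0 - m) - 0) ^ 2) with (sqrt (y0 - m) * sqrt (y0 - m)) by ring.
    rewrite sqrt_sqrt; lra.
  - destruct (Rml x Hx) as [-> ->]. destruct (Rml y Hy) as [-> ->].
    rewrite Hf by assumption. ring.
Qed.

Module RLeOrder <: TotalLeBool.
  Definition t := R.
  Definition leb (x y : R) : bool := if Rle_dec x y then true else false.
  Lemma leb_total (x y : R) : leb x y = true \/ leb y x = true.
  Proof.
    unfold leb. destruct (Rle_dec x y); [now left|].
    destruct (Rle_dec y x); [now right | lra].
  Qed.
End RLeOrder.

Module RSort := Sort RLeOrder.

Lemma snowflake_embedding (l : list R) :
  exists (n : nat) (f : R -> nat -> R),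
    forall x y, In x l -> In y l -> real_sqdist n (f x) (f y) = Rabs (x - y).
Proof.
  assert (leb_le : forall x y, is_true (RLeOrder.leb x y) -> x <= y).
  { intros x y. unfold RLeOrder.leb. now destruct (Rle_dec x y). }
  destruct (sorted_snowflake_embedding (RSort.sort l)) as [n [f Hf]].
  { assert (H : StronglySorted (fun x y => is_true (RLeOrder.leb x y)) (RSort.sort l)).
    { apply RSort.StronglySorted_sort. intros x y z Hxy Hyz.
      apply leb_le in Hxy. apply leb_le in Hyz.
      unfold RLeOrder.leb. destruct (Rle_dec x z); [reflexivity | lra]. }
    induction H as [|x k _ IH Hk]; constructor; [exact IH|].
    eapply Forall_impl; [|exact Hk]. intro. apply leb_le. }
  exists n, f. intros x y Hx Hy.
  apply Hf; (eapply Permutation_in; [apply RSort.Permuted_sort | assumption]).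
Qed.

(** * The Cygan metric *)

Definition emb (f : R -> nat -> R) (zeta : C) (u : R) : nat -> C :=
  vcons zeta (fun k => RtoC (f u k)).

Definition emb_lift (n : nat) (f : R -> nat -> R) (zeta : C) (v u : R) : C :=
  (herm (S n) (emb f zeta u) (emb f zeta u) - Ci * RtoC v)%C.

Lemma emb_is_lift (n : nat) (f : R -> nat -> R) (zeta : C) (v u : R) :
  is_lift (S n) (emb f zeta u) (emb_lift n f zeta v u).
Proof.
  unfold is_lift, emb_lift.
  rewrite Cminus_conj, Cmult_conj, herm_conj, Cconj_RtoC.
  replace (Cconj Ci) with (- Ci)%C; [ring|].
  unfold Cconj, Ci, Copp; simpl; f_equal; ring.
Qed.

(** The real part of the kernel is [|zeta1 - zeta2|^2 + |f u1 - f u2|^2], whose second term is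
    [|u1 - u2|] by hypothesis. The coordinates [f u] are real, so the imaginary part comes from
    [v1], [v2] and [zeta1 * conj zeta2] alone. *)
Lemma cygan_horo_gauge (n : nat) (f : R -> nat -> R) (zeta1 zeta2 : C) (v1 u1 v2 u2 : R) :
  real_sqdist n (f u1) (f u2) = Rabs (u1 - u2) ->
  cygan_horo zeta1 v1 u1 zeta2 v2 u2 =
  gauge (S n) (emb f zeta1 u1) (emb_lift n f zeta1 v1 u1)
              (emb f zeta2 u2) (emb_lift n f zeta2 v2 u2).
Proof.
  intro Hf. unfold cygan_horo, gauge. do 2 f_equal.
  set (F := fun u k => RtoC (f u k)).
  set (G := fun u u' => herm n (F u) (F u')).
  (* Inner products of height vectors are real, hence symmetric, so the two cross terms of the
     squared distance merge. *)
  assert (GR : forall u u', G u u' = RtoC (Re (G u u'))).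
  { intros u u'. generalize (herm_real_im n (f u) (f u')). fold (F u) (F u') (G u u').
    destruct (G u u') as [p q]. unfold Re, Im, RtoC; simpl. now intros ->. }
  assert (GS : G u2 u1 = G u1 u2).
  { rewrite (GR u1 u2), <- re_conj. unfold G at 2. rewrite herm_conj.
    apply GR. }
  assert (Hu : RtoC (Rabs (u1 - u2)) = (G u1 u1 + G u2 u2 - 2 * G u1 u2)%C).
  { rewrite <- Hf. unfold real_sqdist.
    assert (E : forall x y : nat -> R,
      herm n (fun k => RtoC (x k - y k)) (fun k => RtoC (x k - y k)) =
      herm n (fun k => 1 * RtoC (x k) - 1 * RtoC (y k))%C
             (fun k => 1 * RtoC (x k) - 1 * RtoC (y k))%C).
    { clear. induction n as [|m IH]; intros x y; simpl; [reflexivity|].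
      rewrite (IH (fun k => x (S k)) (fun k => y (S k))).
      now rewrite RtoC_minus, !Cmult_1_l. }
    rewrite E, herm_comb, !Cconj_RtoC.
    fold (F u1) (F u2). fold (G u1 u1) (G u1 u2) (G u2 u1) (G u2 u2).
    rewrite GS. generalize (GR u1 u1) (GR u1 u2) (GR u2 u2).
    generalize (G u1 u1) (G u1 u2) (G u2 u2). intros g1 g12 g2 -> -> ->.
    unfold RtoC, Re, Cminus, Cplus, Copp, Cmult; simpl. f_equal; ring. }
  rewrite Hu.
  unfold kernel, emb_lift. rewrite Cminus_conj, herm_conj. cbn [herm emb vcons].
  fold (F u1) (F u2). fold (G u1 u1) (G u1 u2) (G u2 u2).
  rewrite Cmult_conj, Cconj_RtoC.
  generalize (G u1 u1) (G u1 u2) (G u2 u2). intros g1 g12 g2.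
  rewrite Cmod2_conj.
  destruct zeta1 as [p1 q1], zeta2 as [p2 q2], g1, g12, g2.
  unfold Cconj, Ci, RtoC, Im, Cminus, Cplus, Copp, Cmult; simpl. f_equal; ring.
Qed.

(** The real part is a sum of two nonnegative terms, so both vanish; once [zeta1 = zeta2], the
    imaginary part reduces to [- v1 + v2]. *)
Lemma cygan_horo_eq_0 (zeta1 zeta2 : C) (v1 u1 v2 u2 : R) :
  cygan_horo zeta1 v1 u1 zeta2 v2 u2 = 0 -> zeta1 = zeta2 /\ v1 = v2 /\ u1 = u2.
Proof.
  unfold cygan_horo. intro H. apply sqrt_eq_0 in H; [|apply Cmod_ge_0].
  apply Cmod_eq_0 in H.
  assert (HR := f_equal Re H). assert (HI := f_equal Im H). clear H.
  generalize (Rabs_pos (u1 - u2)) (Cmod_ge_0 (zeta1 - zeta2)). intros Hu Hz.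
  assert (HR' : Cmod (zeta1 - zeta2)%C ^ 2 + Rabs (u1 - u2) = 0).
  { refine (eq_trans _ HR). unfold RtoC, Ci, Re, Cminus, Cplus, Copp, Cmult; simpl. ring. }
  assert (Z0 : Cmod (zeta1 - zeta2)%C = 0) by nra.
  assert (U0 : Rabs (u1 - u2) = 0) by nra.
  apply Cmod_eq_0 in Z0.
  assert (E : zeta1 = zeta2).
  { replace zeta1 with (zeta1 - zeta2 + zeta2)%C by ring. rewrite Z0. ring. }
  destruct (Req_dec (u1 - u2) 0) as [E'|E'];
    [|apply Rabs_no_R0 in E'; contradiction].
  subst zeta2. repeat split; [|lra].
  assert (HI' : - v1 + v2 = 0); [|lra].
  refine (eq_trans _ HI). destruct zeta1.
  unfold Cconj, RtoC, Ci, Im, Re, Cminus, Cplus, Copp, Cmult; simpl. ring.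
Qed.

(** * Distances between points, with infinite values replaced by 1 *)

Definition point_dist (p q : point) : R := cancel_infty (cygan p q).

Lemma point_dist_pos (p q : point) : p <> q -> 0 < point_dist p q.
Proof.
  intro Hpq. unfold point_dist.
  destruct p as [z1 z2|], q as [w1 w2|]; simpl; try lra; [|congruence].
  destruct (Rle_lt_or_eq_dec 0 _ (sqrt_pos _ : 0 <= cygan_horo
    (horo_zeta z1 z2) (horo_v z1 z2) (horo_u z1 z2)
    (horo_zeta w1 w2) (horo_v w1 w2) (horo_u w1 w2))) as [H|H]; [exact H|].
  exfalso. apply Hpq. symmetry in H. apply cygan_horo_eq_0 in H.
  apply horospherical_unique in H. destruct H as [H1 H2].
  destruct (proj2 (horospherical_unique z1 z2 _ _ _)
    (conj eq_refl (conj eq_refl eq_refl))) as [H3 H4].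
  congruence.
Qed.

(** The embedding depends on the heights, so one is chosen for all points of [l] at once. *)
Lemma point_dist_gauge (l : list point) :
  exists (n : nat) (x : C -> C -> nat -> C) (a : C -> C -> C),
    (forall z1 z2, is_lift n (x z1 z2) (a z1 z2)) /\
    (forall z1 z2 w1 w2, In (fin_pt z1 z2) l -> In (fin_pt w1 w2) l ->
      point_dist (fin_pt z1 z2) (fin_pt w1 w2) =
      gauge n (x z1 z2) (a z1 z2) (x w1 w2) (a w1 w2)).
Proof.
  (* The height of [infty_pt] is a filler that only adds 0 to the list to be embedded. *)
  set (height := fun p => match p with
                          | fin_pt z1 z2 => horo_u z1 z2
                          | infty_pt => 0
                          end).
  destruct (snowflake_embedding (map height l)) as [n [f Hf]].
  exists (S n), (fun z1 z2 => emb f (horo_zeta z1 z2) (horo_u z1 z2)),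
    (fun z1 z2 => emb_lift n f (horo_zeta z1 z2) (horo_v z1 z2) (horo_u z1 z2)).
  split; [intros; apply emb_is_lift|].
  intros z1 z2 w1 w2 Hz Hw. apply cygan_horo_gauge.
  apply (in_map height) in Hz. apply (in_map height) in Hw.
  now apply Hf.
Qed.

Lemma point_dist_sym (p q : point) : point_dist p q = point_dist q p.
Proof.
  destruct (point_dist_gauge (p :: q :: nil)) as [n [x [a [_ H]]]].
  destruct p, q; try reflexivity.
  rewrite !H by (simpl; tauto). apply gauge_sym.
Qed.

(** At most one point is infinite, and each of the three products contains each point once. A point
    at infinity thus contributes one factor 1 to every product, which leaves the triangle inequality
    for the other three. *)
Lemma point_dist_ptolemy (p q r s : point) :
  p <> q -> p <> r -> p <> s -> q <> r -> q <> s -> r <> s ->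
  point_dist p q * point_dist r s <=
  point_dist p r * point_dist q s + point_dist r q * point_dist p s.
Proof.
  intros pq pr ps qr qs rs.
  destruct (point_dist_gauge (p :: q :: r :: s :: nil)) as [n [x [a [L H]]]].
  assert (T : forall z1 z2 w1 w2 t1 t2,
    let l := p :: q :: r :: s :: nil in
    In (fin_pt z1 z2) l -> In (fin_pt w1 w2) l -> In (fin_pt t1 t2) l ->
    point_dist (fin_pt z1 z2) (fin_pt w1 w2) <=
    point_dist (fin_pt z1 z2) (fin_pt t1 t2) + point_dist (fin_pt t1 t2) (fin_pt w1 w2)).
  { intros. rewrite !H by assumption. now apply gauge_triangle. }
  assert (Di : forall z, z <> infty_pt ->
    point_dist z infty_pt = 1 /\ point_dist infty_pt z = 1).
  { intros [z1 z2|]; [now split | congruence]. }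
  destruct p as [p1 p2|], q as [q1 q2|], r as [r1 r2|], s as [s1 s2|];
    try congruence.
  - generalize (point_dist_pos _ _ ps) (point_dist_pos _ _ qs) (point_dist_pos _ _ rs).
    rewrite !H by (simpl; tauto). now apply gauge_ptolemy.
  (* From here on [s], [r], [q] and [p] are infinite in turn. *)
  - destruct (Di _ ps) as [-> _], (Di _ qs) as [-> _], (Di _ rs) as [-> _].
    rewrite !Rmult_1_r. apply T; simpl; tauto.
  - destruct (Di _ pr) as [-> _], (Di _ qr) as [_ ->], (Di (fin_pt s1 s2)) as [_ ->];
      [congruence|].
    generalize (T p1 p2 q1 q2 s1 s2).
    rewrite (point_dist_sym (fin_pt s1 s2) (fin_pt q1 q2)). simpl.
    intro T'. specialize (T' ltac:(tauto) ltac:(tauto) ltac:(tauto)). lra.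
  - destruct (Di _ pq) as [-> _], (Di (fin_pt s1 s2)) as [_ ->];
      [congruence|].
    destruct (Di (fin_pt r1 r2)) as [-> _]; [congruence|].
    generalize (T r1 r2 s1 s2 p1 p2).
    rewrite (point_dist_sym (fin_pt r1 r2) (fin_pt p1 p2)). simpl.
    intro T'. specialize (T' ltac:(tauto) ltac:(tauto) ltac:(tauto)). lra.
  - destruct (Di (fin_pt q1 q2)) as [_ ->]; [congruence|].
    destruct (Di (fin_pt r1 r2)) as [_ ->]; [congruence|].
    destruct (Di (fin_pt s1 s2)) as [_ ->]; [congruence|].
    generalize (T r1 r2 s1 s2 q1 q2). simpl.
    intro T'. specialize (T' ltac:(tauto) ltac:(tauto) ltac:(tauto)). lra.
Qed.

Theorem theorem3p1 (p1 p2 p3 p4 : point)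
  (h1 : compactified_plane p1) (h2 : compactified_plane p2)
  (h3 : compactified_plane p3) (h4 : compactified_plane p4)
  (h12 : p1 <> p2) (h13 : p1 <> p3) (h14 : p1 <> p4)
  (h23 : p2 <> p3) (h24 : p2 <> p4) (h34 : p3 <> p4) :
  cross_ratio_1 p1 p2 p3 p4 + cross_ratio_2 p1 p2 p3 p4 >= 1 /\
  Rabs (cross_ratio_1 p1 p2 p3 p4 - cross_ratio_2 p1 p2 p3 p4) <= 1.
Proof.
  unfold cross_ratio_1, cross_ratio_2, cross_ratio.
  fold (point_dist p2 p4) (point_dist p2 p3) (point_dist p1 p3) (point_dist p1 p4)
    (point_dist p3 p4) (point_dist p3 p2) (point_dist p1 p2).
  rewrite (point_dist_sym p3 p2).
  (* Three pairings of the points: each of [d12 * d34], [d13 * d24] and [d14 * d23] is at most the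
     sum of the other two. *)
  generalize (point_dist_ptolemy p1 p2 p3 p4 h12 h13 h14 h23 h24 h34).
  generalize (point_dist_ptolemy p1 p3 p2 p4 h13 h12 h14 (not_eq_sym h23) h34 h24).
  generalize (point_dist_ptolemy p1 p4 p2 p3 h14 h12 h13
    (not_eq_sym h24) (not_eq_sym h34) h23).
  rewrite (point_dist_sym p3 p2), (point_dist_sym p4 p3).
  generalize (point_dist_pos _ _ h23) (point_dist_pos _ _ h14).
  generalize (point_dist p1 p2) (point_dist p1 p3) (point_dist p1 p4)
    (point_dist p2 p3) (point_dist p2 p4) (point_dist p3 p4).
  intros d12 d13 d14 d23 d24 d34 P23 P14 T1 T2 T3.
  assert (P : 0 < d14 * d23) by (apply Rmult_lt_0_compat; assumption).
  (* Over the denominator [d14 * d23], the bound on [d14 * d23] gives the sum claim and the other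
     two bounds give the difference claim. *)
  replace (d24 / d23 * (d13 / d14)) with (d13 * d24 / (d14 * d23)) by (field; lra).
  replace (d34 / d23 * (d12 / d14)) with (d12 * d34 / (d14 * d23)) by (field; lra).
  split.
  - rewrite <- Rdiv_plus_distr. apply Rle_ge, Rle_div_r; lra.
  - unfold Rdiv. rewrite <- Rmult_minus_distr_r.
    rewrite Rabs_mult, (Rabs_pos_eq (/ _)) by (left; now apply Rinv_0_lt_compat).
    apply Rle_div_l; [exact P|]. apply Rabs_le. lra.
Qed.
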